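(* Let $R$ be a ring and let $I$ be an ideal of $R$ generated by a (nonempty) regular sequence $x_1,\dots,x_m$, $m\ge 1$. Then, for every $i$, the multiplication map $H^i_I(R)\xrightarrow{\times x}H^i_I(R)$ is surjective for some $x\in I$.
   Context: All rings are commutative, noetherian, with unity. $H^i_I(-)$ denotes local cohomology with support in $I$. *)

(* Defs.v *)
From HB Require Import structures.
From mathcomp Require Import all_boot all_order all_algebra.
From mathcomp Require Import boolp classical_sets.

Set Implicit Arguments.
Unset Strict Implicit.
Unset Printing Implicit Defensive.
Import GRing.Theory.
Local Open Scope ring_scope.
Local Open Scope classical_set_scope.
Local Open Scope quotient_scope.

Section Ideals.
Variable R : comPzRingType.
Implicit Types (I J S : set R).

Definition is_ideal I :=
  [/\ I 0, forall a b, I a -> I b -> I (a + b) & forall r a, I a -> I (r * a)].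

Definition ideal_gen S : set R := smallest is_ideal S.

Definition noetherian :=
  forall I, is_ideal I -> exists s : seq R, I = ideal_gen [set` s].

Definition ideal_mul I J : set R := ideal_gen [set a * b | a in I & b in J].

Fixpoint ideal_pow I (n : nat) : set R :=
  if n is n'.+1 then ideal_mul I (ideal_pow I n') else setT.

(* The first clause says that x_i is a nonzerodivisor on R/(x_j, j < i). *)
Definition regular_sequence (m : nat) (x : 'I_m -> R) :=
  (forall (i : 'I_m) (r : R),
     ideal_gen [set x j | j in [set j : 'I_m | (j < i)%N]] (r * x i) ->
     ideal_gen [set x j | j in [set j : 'I_m | (j < i)%N]] r)
  /\ ideal_gen (range x) <> setT.

Lemma ideal_gen_ideal S : is_ideal (ideal_gen S).
Proof.
split=> [J [[]]//|a b Sa Sb J|r a Sa J] HJ; case: (HJ) => -[J0 JD JM] _.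
  by apply: JD; [exact: Sa|exact: Sb].
by apply: JM; exact: Sa.
Qed.

Lemma ideal_pow_ideal I n : is_ideal (ideal_pow I n).
Proof. by case: n => [|n]; [split|exact: ideal_gen_ideal]. Qed.

Lemma ideal_pow_le I k n : (k <= n)%N -> ideal_pow I n `<=` ideal_pow I k.
Proof.
move=> /subnK <-; elim: (n - k)%N => [|p IH]; first exact: subset_refl.
apply: subset_trans IH => /=.
apply: smallest_sub; first exact: ideal_pow_ideal.
by move=> _ [a _ [b Ib <-]]; case: (ideal_pow_ideal I (p + k)) => _ _; apply.
Qed.

End Ideals.

Section Submodules.
Variables (R : pzRingType) (M : lmodType R) (N : submodClosed M).

Record submod_type := SubmodElt {
  submod_val :> M;
  submod_valP : submod_val \in N
}.

HB.instance Definition _ := [isSub for submod_val].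
HB.instance Definition _ := [Choice of submod_type by <:].
HB.instance Definition _ := [SubChoice_isSubLmodule of submod_type by <:].

(* The library does not infer a zmodClosed structure from a submodClosed one. *)
Definition submod_pred : M -> bool := fun x => x \in N.

Lemma submod_pred_zmod : zmod_closed submod_pred.
Proof. exact: GRing.submod_closedB (submodClosedP N). Qed.

HB.instance Definition _ :=
  GRing.isZmodClosed.Build M submod_pred submod_pred_zmod.

Definition quot_module := Quotient.quot (GRing.ZmodClosed.clone M submod_pred _).

HB.instance Definition _ := GRing.Zmodule.on quot_module.
HB.instance Definition _ := EqQuotient.on quot_module.

Definition quot_pi (x : M) : quot_module := \pi_quot_module x.

Lemma eq_quot_pi x y : (quot_pi x = quot_pi y) <-> x - y \in N.
Proof.
rewrite -[_ \in N]/(x - y \in submod_pred) Quotient.idealrBE.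
by split=> [/eqP|/eqP].
Qed.

Lemma quot_piD x y : quot_pi (x + y) = quot_pi x + quot_pi y.
Proof. exact: Quotient.pi_add. Qed.

Lemma quot_pi_surj q : exists x, q = quot_pi x.
Proof. by exists (repr q); rewrite /quot_pi reprK. Qed.

Definition quot_scale (a : R) (q : quot_module) : quot_module :=
  quot_pi (a *: repr q).

Lemma quot_pi_scale a x : quot_scale a (quot_pi x) = quot_pi (a *: x).
Proof.
apply/eq_quot_pi; rewrite -scalerBr rpredZ //.
by apply/eq_quot_pi; rewrite /quot_pi reprK.
Qed.

Lemma quot_scaleA a b q : quot_scale a (quot_scale b q) = quot_scale (a * b) q.
Proof. by have [x ->] := quot_pi_surj q; rewrite !quot_pi_scale scalerA. Qed.

Lemma quot_scale1 : left_id 1 quot_scale.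
Proof.
by move=> q; have [x ->] := quot_pi_surj q; rewrite quot_pi_scale scale1r.
Qed.

Lemma quot_scaleDr : right_distributive quot_scale +%R.
Proof.
move=> a p q; have [x ->] := quot_pi_surj p; have [y ->] := quot_pi_surj q.
by rewrite -quot_piD !quot_pi_scale scalerDr quot_piD.
Qed.

Lemma quot_scaleDl q : {morph quot_scale^~ q : a b / a + b}.
Proof.
move=> a b; have [x ->] := quot_pi_surj q.
by rewrite !quot_pi_scale scalerDl quot_piD.
Qed.

HB.instance Definition _ := GRing.Zmodule_isLmodule.Build R quot_module
  quot_scaleA quot_scale1 quot_scaleDr quot_scaleDl.

End Submodules.

Record cochain_complex (R : pzRingType) := CochainComplex {
  cobj :> nat -> lmodType R;
  cdiff : forall n, {linear cobj n -> cobj n.+1};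
  cdiffK : forall n x, cdiff n.+1 (cdiff n x) = 0
}.

Section Cohomology.
Variables (R : pzRingType) (C : cochain_complex R) (n : nat).

Definition is_cocycle : pred (C n) := fun x => cdiff C n x == 0.

Lemma cocycle_closed : submod_closed is_cocycle.
Proof.
split; first by rewrite unfold_in raddf0.
move=> a x y; rewrite !unfold_in => /eqP x0 /eqP y0.
by rewrite linearP x0 y0 scaler0 addr0.
Qed.

HB.instance Definition _ :=
  GRing.isSubmodClosed.Build R (C n) is_cocycle cocycle_closed.

Definition cocycles : submodClosed (C n) :=
  GRing.SubmodClosed.clone R (C n) is_cocycle _.

(* Coboundaries are zero in degree 0: the complex is extended by 0 on the
   left. *)
Definition coboundary_set (k : nat) : set (C k) :=
  match k with
  | 0 => [set 0]
  | k'.+1 => range (cdiff C k')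
  end.

Definition is_coboundary : submod_type cocycles -> bool :=
  fun z => `[< coboundary_set (val z) >].

Lemma coboundary_closed : submod_closed is_coboundary.
Proof.
suff [B0 BP] : coboundary_set (0 : C n) /\
    forall a (u v : C n), coboundary_set u -> coboundary_set v ->
      coboundary_set (a *: u + v).
  split; first by apply/asboolP; rewrite raddf0.
  move=> a u v /asboolP Bu /asboolP Bv; apply/asboolP.
  by rewrite linearP; apply: BP.
case: (n) => [|k] /=; first by split=> // a _ _ -> ->; rewrite scaler0 addr0.
split=> [|a _ _ [u _ <-] [v _ <-]]; first by exists 0; rewrite ?raddf0.
by exists (a *: u + v); rewrite ?linearP.
Qed.

HB.instance Definition _ :=
  GRing.isSubmodClosed.Build R (submod_type cocycles) is_coboundary
    coboundary_closed.

Definition coboundaries : submodClosed (submod_type cocycles) :=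
  GRing.SubmodClosed.clone R (submod_type cocycles) is_coboundary _.

Definition cohomology : lmodType R := quot_module coboundaries.

End Cohomology.

Section Torsion.
Variables (R : comPzRingType) (I : set R).

Section Module.
Variable M : lmodType R.

Definition is_torsion : pred M :=
  fun m => `[< exists n, forall a, ideal_pow I n a -> a *: m = 0 >].

Lemma torsion_closed : submod_closed is_torsion.
Proof.
split; first by apply/asboolP; exists 0%N => a _; rewrite scaler0.
move=> r u v /asboolP[k uk] /asboolP[l vl]; apply/asboolP.
exists (maxn k l) => a Ia.
rewrite scalerDr scalerA mulrC -scalerA uk ?vl ?scaler0 ?addr0 //.
  exact: ideal_pow_le (leq_maxr k l) _ Ia.
exact: ideal_pow_le (leq_maxl k l) _ Ia.
Qed.

HB.instance Definition _ :=
  GRing.isSubmodClosed.Build R M is_torsion torsion_closed.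

Definition torsion : submodClosed M :=
  GRing.SubmodClosed.clone R M is_torsion _.

Definition torsion_module : lmodType R := submod_type torsion.

End Module.

Section Map.
Variables (M N : lmodType R) (f : {linear M -> N}).

Lemma torsion_mapP (m : torsion_module M) : f (val m) \in torsion N.
Proof.
case: m => m /= /asboolP[n mn]; apply/asboolP; exists n => a Ia.
by rewrite -linearZ mn ?raddf0.
Qed.

Definition torsion_map (m : torsion_module M) : torsion_module N :=
  SubmodElt (torsion_mapP m).

Lemma torsion_map_linear : linear torsion_map.
Proof. by move=> a u v; apply: val_inj; rewrite /= !linearP. Qed.

HB.instance Definition _ :=
  GRing.isLinear.Build R (torsion_module M) (torsion_module N) _ torsion_map
    torsion_map_linear.

End Map.

Lemma torsion_complexK (C : cochain_complex R) n (m : torsion_module (C n)) :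
  torsion_map (cdiff C n.+1) (torsion_map (cdiff C n) m) = 0.
Proof. by apply: val_inj; rewrite /= cdiffK. Qed.

Definition torsion_complex (C : cochain_complex R) : cochain_complex R :=
  @CochainComplex R (fun n => torsion_module (C n))
    (fun n => torsion_map (cdiff C n)) (@torsion_complexK C).

End Torsion.

Definition injective_module (R : pzRingType) (E : lmodType R) :=
  forall (A B : lmodType R) (f : {linear A -> B}) (g : {linear A -> E}),
    injective f -> exists h : {linear B -> E}, forall a, h (f a) = g a.

Record injective_resolution (R : pzRingType) (M : lmodType R) := InjRes {
  ires :> cochain_complex R;
  iaug : {linear M -> ires 0%N};
  ires_injective : forall n, injective_module (ires n);
  iaug_inj : injective iaug;
  iaug_exact : range iaug = [set e | cdiff ires 0 e = 0];
  ires_exact : forall n,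
    range (cdiff ires n) = [set e | cdiff ires n.+1 e = 0]
}.

(* The i-th right derived functor of the I-torsion functor, computed on a
   chosen injective resolution E of M; it is independent of E up to
   isomorphism. *)
Definition local_cohomology (R : comPzRingType) (I : set R) (M : lmodType R)
    (E : injective_resolution M) (i : nat) : lmodType R :=
  cohomology (torsion_complex I E) i.

(* Main.v *)
Require Import Defs.
From HB Require Import structures.
From mathcomp Require Import all_boot all_order all_algebra.
From mathcomp Require Import boolp classical_sets.
From mathcomp Require Import ring.
Import GRing.Theory.
Local Open Scope ring_scope.
Local Open Scope classical_set_scope.

(* Write y for the last element of the sequence, s for the others, and E[K]
   for the subcomplex of the injective resolution E killed by the ideal K.
   When a is a nonzerodivisor modulo K, injectivity makes E[K] divisible by a,
   so that 0 -> E[K + (a)] -> E[K] -a-> E[K] -> 0 is exact. By induction along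
   a regular sequence of length k generating K, the cohomology of E[K]
   vanishes outside degree k, and is R/K there. This applies to the n-th
   powers of the sequence, which are again regular, for every n. An I-torsion
   cocycle e is killed by the n-th powers for some n > 0, and it bounds in
   E[K] for K = (s^n): by vanishing in E[K] or, in degree |s|, by vanishing in
   E[K + (y^n)]. So e = dw with w in E[K], w = y w' with w' in E[K], and dw'
   is I-torsion with y dw' = e. *)

(** * Regular sequences modulo an ideal, and their powers *)

Section RegularSequences.
Context {R : comPzRingType}.
Implicit Types (K : set R) (x y r : R) (s : seq R).

Definition ideal_adjoin K x : set R := [set r | exists c, K (r - c * x)].

Definition nzd_mod K x := forall r, K (r * x) -> K r.

Fixpoint regular_mod K s : Prop :=
  if s is x :: s' then nzd_mod K x /\ regular_mod (ideal_adjoin K x) s'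
  else True.

Lemma ideal_adjoin_ideal K x : is_ideal K -> is_ideal (ideal_adjoin K x).
Proof.
move=> [K0 KD KM]; split.
- by exists 0; rewrite mul0r subr0.
- move=> a b [c Kc] [d Kd]; exists (c + d).
  by have := KD _ _ Kc Kd; congr K; ring.
- move=> r a [c Kc]; exists (r * c).
  by have := KM r _ Kc; congr K; ring.
Qed.

Lemma ideal_adjoin_sub K x : K `<=` ideal_adjoin K x.
Proof. by move=> a Ka; exists 0; rewrite mul0r subr0. Qed.

Lemma ideal_adjoin_id K x : is_ideal K -> ideal_adjoin K x x.
Proof. by case=> K0 _ _; exists 1; rewrite mul1r subrr. Qed.

Lemma ideal_adjoinAC K x y :
  ideal_adjoin (ideal_adjoin K x) y = ideal_adjoin (ideal_adjoin K y) x.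
Proof.
by apply/seteqP; split=> a [c [d Kcd]]; exists d, c; move: Kcd; congr K; ring.
Qed.

Lemma foldl_adjoin_ideal K s : is_ideal K -> is_ideal (foldl ideal_adjoin K s).
Proof.
by elim: s K => [//|x s IHs] K idK /=; apply: IHs; apply: ideal_adjoin_ideal.
Qed.

Lemma foldl_adjoin_gen s : foldl ideal_adjoin [set 0] s = ideal_gen [set` s].
Proof.
have id0 : is_ideal [set (0 : R)].
  by split=> [//|a b -> ->|r a ->]; rewrite ?addr0 ?mulr0.
apply/seteqP; split=> [a|].
  have id_gen := ideal_gen_ideal [set` s]; case: (id_gen) => g0 gD gM.
  have : [set 0] `<=` ideal_gen [set` s] by move=> _ ->.
  have : [set` s] `<=` ideal_gen [set` s] by exact: sub_gen_smallest.
  (* Generalized for the induction: [G] is only closed under sums and multiples and contains [K] and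
     [s]. *)
  move: [set 0] {id0} (ideal_gen _) gD gM {g0 id_gen} => K G gD gM.
  elim: s K a => [|x s IHs] K a sG KG /=; first exact: KG.
  apply: IHs => [y ys|b [c Kbc]]; first by apply: sG; rewrite /= inE orbC ys.
  rewrite -(subrK (c * x) b); apply: gD; first exact: KG.
  by apply/gM/sG; rewrite /= mem_head.
apply: smallest_sub; first exact: foldl_adjoin_ideal.
elim/last_ind: s => [//|s x IHs] y /=; rewrite mem_rcons inE.
rewrite -cats1 foldl_cat /=.
case/orP=> [/eqP->|/IHs]; last exact: ideal_adjoin_sub.
by apply: ideal_adjoin_id; apply: foldl_adjoin_ideal.
Qed.

Lemma nzd_modX {K x} n : is_ideal K -> nzd_mod K x -> nzd_mod K (x ^+ n).
Proof.
move=> idK Kx; elim: n => [|n IHn] r; first by rewrite mulr1.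
by rewrite exprSr mulrA => /Kx/IHn.
Qed.

(** If [u * x = v * y] modulo [K], regularity of [y] gives [v = w * x], and cancelling [x] gives
    [u = w * y]. Modulo [K] itself, [y] may be a zero divisor. *)
Lemma nzd_mod_swap {K x y} : is_ideal K ->
  nzd_mod K x -> nzd_mod (ideal_adjoin K x) y -> nzd_mod (ideal_adjoin K y) x.
Proof.
move=> idK Kx Kxy u [v Kuv]; case: (idK) => _ KD KM.
have /Kxy[w Kw] : ideal_adjoin K x (v * y).
  by exists u; have := KM (-1) _ Kuv; congr K; ring.
exists w; apply: Kx; have := KD _ _ Kuv (KM y _ Kw); congr K; ring.
Qed.

(** Induction on [n]: modulo [K], [z * y = v * x ^+ n.+1] forces [z = u * x], and cancelling [x]
    leaves [u * y = v * x ^+ n]. *)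
Lemma nzd_mod_adjoinX {K x y} n : is_ideal K ->
  nzd_mod K x -> nzd_mod (ideal_adjoin K x) y ->
  nzd_mod (ideal_adjoin K (x ^+ n)) y.
Proof.
move=> idK Kx Kxy; have Kyx := nzd_mod_swap idK Kx Kxy.
case: (idK) => K0 KD KM.
elim: n => [|n IHn] z; first by exists z; rewrite expr0 mulr1 subrr.
case=> v Kzv.
have /Kxy[u Ku] : ideal_adjoin K x (z * y).
  by exists (v * x ^+ n); move: Kzv; rewrite exprSr; congr K; ring.
have /IHn[w Kw] : ideal_adjoin K (x ^+ n) (u * y).
  exists v; apply: Kx; have := KD _ _ Kzv (KM (- y) _ Ku).
  by rewrite exprSr; congr K; ring.
by exists w; have := KD _ _ Ku (KM x _ Kw); rewrite exprSr; congr K; ring.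
Qed.

Lemma regular_mod_adjoinX {K x s} n : is_ideal K ->
  nzd_mod K x -> regular_mod (ideal_adjoin K x) s ->
  regular_mod (ideal_adjoin K (x ^+ n)) s.
Proof.
elim: s K => [//|y s IHs] K idK Kx /= [Kxy regs]; split.
  exact: nzd_mod_adjoinX.
(* Adjoin [y] first: [x] stays a nonzerodivisor modulo [K + (y)]. *)
rewrite ideal_adjoinAC; apply: IHs; first exact: ideal_adjoin_ideal.
  exact: nzd_mod_swap.
by rewrite ideal_adjoinAC.
Qed.

Lemma regular_modX {K s} n : is_ideal K -> regular_mod K s ->
  regular_mod K [seq x ^+ n | x <- s].
Proof.
elim: s K => [//|x s IHs] K idK /= [Kx regs]; split; first exact: nzd_modX.
apply: IHs; first exact: ideal_adjoin_ideal.
exact: regular_mod_adjoinX.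
Qed.

Lemma regular_mod_rcons K s x : regular_mod K (rcons s x) <->
  regular_mod K s /\ nzd_mod (foldl ideal_adjoin K s) x.
Proof.
elim: s K => [|y s IHs] K /=; first by split=> -[].
by rewrite IHs; split=> [[? []]|[[]]].
Qed.

Lemma regular_modP K s :
  (forall k, (k < size s)%N ->
     nzd_mod (foldl ideal_adjoin K (take k s)) s`_k) ->
  regular_mod K s.
Proof.
elim: s K => [//|x s IHs] K regs; split; first exact: (regs 0%N).
by apply: IHs => k ks; apply: (regs k.+1).
Qed.

Lemma regular_sequence_mod m (x : 'I_m -> R) :
  regular_sequence x -> regular_mod [set 0] (codom x).
Proof.
case=> regx _; apply: regular_modP => k; rewrite size_codom card_ord => km.
rewrite foldl_adjoin_gen (nth_map (Ordinal km)) ?size_enum_ord//.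
rewrite (_ : nth _ _ _ = Ordinal km); last first.
  by apply: val_inj; rewrite /= nth_enum_ord.
rewrite /codom /image_mem -map_take.
suff -> : [set` [seq x j | j <- take k (enum 'I_m)]] =
    [set x j | j in [set j : 'I_m | (j < k)%N]] by exact: (regx (Ordinal km)).
have mem_takeE (j : 'I_m) : (j \in take k (enum 'I_m)) = (j < k)%N.
  by rewrite in_take ?mem_enum// index_enum_ord.
apply/seteqP; split=> [_ /= /mapP[j + ->]|_ [j jk <-]].
  by rewrite mem_takeE => jk; exists j.
by apply/mapP; exists j; rewrite ?mem_takeE.
Qed.

End RegularSequences.

(** * Elements of a module killed by an ideal *)

Section Annihilated.
Context {R : comPzRingType} {M : lmodType R}.
Implicit Types (K : set R) (x : R) (s : seq R) (e : M).

(** These [e] form Hom(R/K, M), through evaluation at 1. *)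
Definition killed K e := forall a, K a -> a *: e = 0.

Lemma killed0 K : killed K 0.
Proof. by move=> a _; rewrite scaler0. Qed.

Lemma killedB K e e' : killed K e -> killed K e' -> killed K (e - e').
Proof. by move=> Ke Ke' a Ka; rewrite scalerBr Ke// Ke'// subr0. Qed.

Lemma killedZ K r e : killed K e -> killed K (r *: e).
Proof. by move=> Ke a Ka; rewrite scalerA mulrC -scalerA Ke// scaler0. Qed.

Lemma killed_adjoin {K x e} : is_ideal K ->
  killed (ideal_adjoin K x) e <-> killed K e /\ x *: e = 0.
Proof.
move=> idK; split=> [Ke|[Ke xe] a [c /Ke]].
  split=> [a Ka|]; apply: Ke; first exact: ideal_adjoin_sub.
  exact: ideal_adjoin_id.
by move/eqP; rewrite scalerBl -scalerA xe scaler0 subr0 => /eqP.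
Qed.

Lemma killed_foldl_adjoin K s e : is_ideal K ->
  killed (foldl ideal_adjoin K s) e <->
  killed K e /\ forall x, x \in s -> x *: e = 0.
Proof.
elim: s K => [|x s IHs] K idK /=; first by split=> [|[]].
rewrite IHs; last exact: ideal_adjoin_ideal.
rewrite killed_adjoin//; split=> [[[Ke xe] se]|[Ke se]].
  by split=> // y; rewrite inE => /predU1P[->|/se].
split; first by split=> //; apply: se; rewrite mem_head.
by move=> y ys; apply: se; rewrite inE ys orbT.
Qed.

(* Extend the map [a |-> r *: e], where [a = r * x] modulo [K], from the ideal
   [K + (x)] to [R] and evaluate at 1. *)
Lemma killed_divisible K x e : injective_module M -> is_ideal K ->
  nzd_mod K x -> killed K e -> exists2 e', killed K e' & x *: e' = e.
Proof.
move=> injM idK Kx Ke.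
have [L0 LD LM] := ideal_adjoin_ideal K x idK; have [K0 KD KM] := idK.
pose p : pred R^o := fun r => `[< ideal_adjoin K x r >].
have p_closed : submod_closed p.
  split=> [|r a b /asboolP pa /asboolP pb]; first exact/asboolP.
  by apply/asboolP; apply: LD => //; apply: LM.
pose N : submodClosed R^o :=
  HB.pack p (GRing.isSubmodClosed.Build R R^o p p_closed).
pose A : lmodType R := submod_type N.
have quoP (a : A) : ideal_adjoin K x (val a) by exact/asboolP/(valP a).
pose quo (a : A) := projT1 (cid (quoP a)).
have quoK (a : A) : K (val a - quo a * x) by exact: projT2 (cid (quoP a)).
(* Well-definedness: [r] is unique modulo [K] because [x] is a nonzerodivisor there, and [K] kills
   [e]. *)
have quoE (a : A) r : K (val a - r * x) -> quo a *: e = r *: e.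
  move=> Kr; apply/eqP; rewrite -subr_eq0 -scalerBl; apply/eqP/Ke/Kx.
  by have := KD _ _ Kr (KM (-1) _ (quoK a)); congr K; ring.
pose g (a : A) : M := quo a *: e.
have g_linear : linear g.
  move=> r a b; rewrite /g (@quoE _ (r * quo a + quo b)) ?scalerDl ?scalerA//.
  have := KD _ _ (KM r _ (quoK a)) (quoK b); congr K.
  rewrite linearP /= /GRing.scale/=; ring.
pose gL : {linear A -> M} :=
  HB.pack g (GRing.isLinear.Build R A M _ g g_linear).
have [h hE] := injM A R^o val gL val_inj.
have hZ (r : R) : h r = r *: h 1.
  by rewrite -linearZ /= /GRing.scale/= mulr1.
have pN (a : R) : ideal_adjoin K x a -> (a : R^o) \in N by move/asboolP.
have gE a r : ideal_adjoin K x a -> K (a - r * x) -> a *: h 1 = r *: e.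
  move=> /pN La Kr; have := hE (SubmodElt La); rewrite /= hZ => ->.
  exact: quoE.
exists (h 1) => [a Ka|].
  rewrite (gE _ 0) ?scale0r ?mul0r ?subr0//; exact: ideal_adjoin_sub.
by rewrite (gE _ 1) ?scale1r ?mul1r ?subrr//; exact: ideal_adjoin_id.
Qed.

End Annihilated.

(** * Cohomology of the subcomplex killed by an ideal *)

Section KilledCohomology.
Context {R : comPzRingType} {C : cochain_complex R}.
Implicit Types (K : set R) (x y : R) (s : seq R) (i p : nat).

(** The primitive [w] must itself be killed by [K]: these are coboundaries of the subcomplex. *)
Definition killed_boundary K i : set (C i) :=
  match i with
  | 0 => [set 0]
  | j.+1 => [set cdiff C j w | w in killed K]
  end.
Arguments killed_boundary : clear implicits.

(* The cohomology of the [K]-killed subcomplex vanishes outside degree [p], and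
   in degree [p] it is isomorphic to [R / K]. *)
Definition killed_concentrated K p :=
  (forall i (z : C i), i <> p -> killed K z -> cdiff C i z = 0 ->
     killed_boundary K i z) /\
  exists g : C p,
    [/\ killed K g, cdiff C p g = 0,
        forall z : C p, killed K z -> cdiff C p z = 0 ->
          exists r, killed_boundary K p (z - r *: g) &
        forall r, killed_boundary K p (r *: g) -> K r].

Lemma killed_diff K i (w : C i) : killed K w -> killed K (cdiff C i w).
Proof. by move=> Kw a Ka; rewrite -linearZ Kw ?raddf0. Qed.

Lemma killed_boundary_killed K i z : killed_boundary K i z -> killed K z.
Proof.
case: i z => [|i] z /=; first by move=> ->; apply: killed0.
by case=> w Kw <-; apply: killed_diff.
Qed.

Lemma killed_boundary_cocycle K i z :
  killed_boundary K i z -> cdiff C i z = 0.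
Proof.
case: i z => [|i] z /=; first by move=> ->; rewrite raddf0.
by case=> w _ <-; rewrite cdiffK.
Qed.

Lemma killed_boundaryZ K i r z :
  killed_boundary K i z -> killed_boundary K i (r *: z).
Proof.
case: i z => [|i] z /=; first by move=> ->; rewrite scaler0.
by case=> w Kw <-; exists (r *: w); [exact: killedZ|rewrite linearZ].
Qed.

Hypothesis injC : forall i, injective_module (C i).

Lemma killed_boundary_divisible K x i z : is_ideal K -> nzd_mod K x ->
  killed_boundary K i z -> exists2 z', killed_boundary K i z' & x *: z' = z.
Proof.
move=> idK Kx; case: i z => [|i] z /=.
  by move=> ->; exists 0; rewrite ?scaler0.
case=> w Kw <-.
have [w' Kw' <-] := killed_divisible K x w (injC i) idK Kx Kw.
by exists (cdiff C i w'); [exists w'|rewrite linearZ].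
Qed.

(** Write [z = dw]. Then [x *: w] is a cocycle, hence a coboundary [x *: b] with [b] a coboundary;
    [w - b] is killed by [x] and still bounds [z]. *)
Lemma killed_boundary_adjoin K x i z : is_ideal K -> nzd_mod K x ->
  (forall j (w : C j), i = j.+1 -> killed K w -> cdiff C j w = 0 ->
     killed_boundary K j w) ->
  killed_boundary K i z -> x *: z = 0 ->
  killed_boundary (ideal_adjoin K x) i z.
Proof.
move=> idK Kx; case: i z => [//|i] z exactK /= [w Kw <-] xz.
have : killed_boundary K i (x *: w).
  by apply: exactK; rewrite ?linearZ//; apply: killedZ.
case/(killed_boundary_divisible _ x _ _ idK Kx) => b Kb xb.
exists (w - b); last first.
  by rewrite linearB /= (killed_boundary_cocycle _ _ _ Kb) subr0.
apply/(killed_adjoin idK); split; last by rewrite scalerBr xb subrr.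
by apply: killedB => //; apply: killed_boundary_killed Kb.
Qed.

(* The long exact sequence of [0 -> C[K + (x)] -> C[K] -x-> C[K] -> 0], where
   [C[K]] denotes the [K]-killed subcomplex. *)
Lemma killed_concentrated_adjoin K x p : is_ideal K -> nzd_mod K x ->
  killed_concentrated K p -> killed_concentrated (ideal_adjoin K x) p.+1.
Proof.
move=> idK Kx [exactK [g [Kg dg genK annK]]]; have [K0 KD KM] := idK.
split=> [i z neq_ip /(killed_adjoin idK)[Kz xz] dz|].
  apply: killed_boundary_adjoin => // [j w ij Kw dw|].
    by apply: exactK => // jp; rewrite ij jp in neq_ip.
  have [eq_ip|/exactK] := pselect (i = p); last exact.
  move: eq_ip z Kz xz dz {neq_ip} => -> z Kz xz dz.
  (* In degree [p], multiplication by [x] is injective on cohomology: [x *: z = 0] puts [r * x],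
     hence [r], in [K], so [r *: g = 0]. *)
  have [r zr] := genK z Kz dz.
  have Kr : K r.
    suff /annK : killed_boundary K p ((- r * x) *: g).
      by move/Kx/(KM (-1)); congr K; ring.
    have := killed_boundaryZ K p x _ zr.
    by rewrite scalerBr xz sub0r scalerA -scaleNr mulrC mulNr.
  by move: zr; rewrite (Kg r Kr) subr0.
(* The new generator is the image of [g] under the connecting map: divide by [x], then
   differentiate. *)
have [g' Kg' xg'] := killed_divisible K x g (injC p) idK Kx Kg.
exists (cdiff C p g'); split.
- apply/(killed_adjoin idK); split; first exact: killed_diff.
  by rewrite -linearZ xg'.
- exact: cdiffK.
- move=> z /(killed_adjoin idK)[Kz xz] dz.
  have [w Kw zw] : killed_boundary K p.+1 z.
    by apply: exactK => //; apply/eqP; rewrite gtn_eqF.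
  (* As [d(x *: w) = x *: z = 0], the class of [x *: w] is a multiple of that of [g]; dividing the
     relation by [x] corrects [w]. *)
  have [||r] := genK (x *: w); first exact: killedZ.
    by rewrite linearZ /= zw.
  case/(killed_boundary_divisible _ x _ _ idK Kx) => b Kb xb.
  exists r, (w - r *: g' - b); last first.
    by rewrite !linearB linearZ /= zw (killed_boundary_cocycle _ _ _ Kb) subr0.
  apply/(killed_adjoin idK); split.
    apply: killedB; last exact: killed_boundary_killed Kb.
    by apply: killedB => //; apply: killedZ.
  by rewrite !scalerBr xb [x *: (r *: _)]scalerA mulrC -scalerA xg' subrr.
- move=> r /= [u /(killed_adjoin idK)[Ku xu] du].
  (* [r *: g' - u] is a cocycle, so cohomologous to some [c *: g]; multiplying by [x] makes
     [(r - c * x) *: g] a coboundary. *)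
  have [||c /(killed_boundaryZ _ _ x)] := genK (r *: g' - u).
  + by apply: killedB => //; apply: killedZ.
  + by rewrite linearB linearZ /= du subrr.
  rewrite !scalerBr xu subr0 scalerA mulrC -scalerA xg' scalerA -scalerBl.
  by move=> /annK Kr; exists c; rewrite mulrC.
Qed.

Lemma killed_concentrated_foldl K s p : is_ideal K -> regular_mod K s ->
  killed_concentrated K p ->
  killed_concentrated (foldl ideal_adjoin K s) (size s + p).
Proof.
elim: s K p => [//|x s IHs] K p idK /= [Kx regs] concK.
rewrite addSnnS; apply: IHs => //; first exact: ideal_adjoin_ideal.
exact: killed_concentrated_adjoin.
Qed.

End KilledCohomology.

Arguments killed_boundary {R} C K i.
Arguments killed_concentrated {R} C K p.

(** Base case: the ideal 0 kills everything, so this is the exactness of [E], with the augmentation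
    of 1 as generator. *)
Lemma injective_resolution_concentrated {R : comPzRingType}
    (E : injective_resolution (R^o : lmodType R)) :
  killed_concentrated E [set 0] 0.
Proof.
have killed_zero (M : lmodType R) (e : M) : killed [set 0] e.
  by move=> _ ->; rewrite scale0r.
split=> [[//|i] z _ _ dz|].
  have : [set e | cdiff E i.+1 e = 0] z by [].
  by rewrite -ires_exact => -[w _ <-]; exists w.
exists (iaug E 1); split=> // [|z _ dz|r].
- have : range (iaug E) (iaug E 1) by exists 1.
  by rewrite iaug_exact.
- have : [set e | cdiff E 0 e = 0] z by [].
  rewrite -iaug_exact => -[r _ <-]; exists r.
  by rewrite -linearZ /= /GRing.scale /= mulr1 subrr.
- rewrite /= -linearZ /= => e0; apply: (@iaug_inj _ _ E).
  by rewrite raddf0 -e0; congr (iaug E _); rewrite /GRing.scale /= mulr1.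
Qed.

(** * Torsion in terms of powers of the generators *)

Section PowerTorsion.
Context {R : comPzRingType} {M : lmodType R} {m : nat} (x : 'I_m -> R).
Let I := ideal_gen (range x).
Implicit Types e : M.

Lemma transporter_ideal J e :
  is_ideal J -> is_ideal [set a | forall b, J b -> (a * b) *: e = 0].
Proof.
move=> [J0 JD JM]; split=> [b _|a c ae ce b Jb|r a ae b Jb].
- by rewrite mul0r scale0r.
- by rewrite mulrDl scalerDl ae// ce// addr0.
- by rewrite -mulrA -scalerA ae// scaler0.
Qed.

(** The exponents vary with the generator for the induction on [N]: [x j *: e] needs one power of
    [x j] less. *)
Lemma killed_ideal_pow N (n : 'I_m -> nat) e : (0 < m)%N ->
  (\sum_j n j <= N)%N -> (forall j, x j ^+ n j *: e = 0) ->
  killed (ideal_pow I N) e.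
Proof.
move=> m_gt0; elim: N n e => [|N IHN] n e.
  (* All exponents are 0 here, and the zeroth power of an existing generator gives [e = 0]. *)
  rewrite leqn0 sum_nat_eq0 => /forallP/(_ (Ordinal m_gt0))/eqP n0 xe a _.
  have := xe (Ordinal m_gt0).
  by rewrite n0 expr0 scale1r => ->; rewrite scaler0.
move=> le_n xe.
have idN := ideal_pow_ideal I N.
have gen_e : range x `<=`
    [set a | forall b, ideal_pow I N b -> (a * b) *: e = 0].
  move=> _ [j _ <-] b Ib; rewrite mulrC -scalerA.
  case nj: (n j) => [|k].
    by have := xe j; rewrite nj expr0 scale1r => ->; rewrite !scaler0.
  pose n' i := (n i - (i == j))%N.
  apply: (IHN n') => // [|i].
    rewrite -ltnS; apply: leq_trans le_n.
    rewrite (bigD1 j)//= [ltnRHS](bigD1 j)//= /n' eqxx nj subn1.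
    rewrite addSn ltnS leq_add2l.
    by apply: leq_sum => i _; apply: leq_subr.
  rewrite scalerA /n'; have [->|_] := eqVneq i j; last first.
    by rewrite subn0 mulrC -scalerA xe scaler0.
  by rewrite -exprSr nj subn1 -nj xe.
have IJ := smallest_sub (transporter_ideal _ e idN) gen_e.
apply: (smallest_sub _ (_ : [set a * b | a in I & b in ideal_pow I N] `<=`
  [set c | c *: e = 0])).
  split=> [|a b /= ae be|r a /= ae]; first by rewrite /= scale0r.
    by rewrite scalerDl ae be addr0.
  by rewrite -scalerA ae scaler0.
by move=> _ [a Ia [b Ib <-]]; apply: IJ.
Qed.

Lemma ideal_powX a n : I a -> ideal_pow I n (a ^+ n).
Proof.
move=> Ia; elim: n => [//|n IHn]; rewrite exprS.
by apply: sub_gen_smallest; exists a => //; exists (a ^+ n).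
Qed.

Lemma is_torsionP e : (0 < m)%N ->
  is_torsion I e <-> exists n, forall a, a \in codom x -> a ^+ n *: e = 0.
Proof.
move=> m_gt0; split=> [/asboolP[n Ie]|[n xe]].
  exists n => _ /codomP[j ->]; apply/Ie/ideal_powX.
  by apply: sub_gen_smallest; exists j.
apply/asboolP; exists (\sum_(j < m) n)%N.
by apply: killed_ideal_pow (leqnn _) _ => // j; apply: xe; apply: codom_f.
Qed.

End PowerTorsion.

(** * Divisibility of local cohomology *)

Lemma local_cohomology_divisible {R : comPzRingType} (I : set R)
    (M : lmodType R) (E : injective_resolution M) (i : nat) (y : R) :
  (forall e : E i, is_torsion I e -> cdiff E i e = 0 ->
     exists e' : E i, [/\ is_torsion I e', cdiff E i e' = 0 & y *: e' = e]) ->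
  forall h : local_cohomology I E i, exists h' : local_cohomology I E i,
    y *: h' = h.
Proof.
move=> divE h; have [[[e te] /= de] ->] := quot_pi_surj h.
have /(congr1 val)/= de0 := eqP de.
have [e' [te' de' ye']] := divE e te de0.
have cocyc : SubmodElt te' \in cocycles (torsion_complex I E) i.
  by apply/eqP/val_inj.
exists (quot_pi _ (SubmodElt cocyc)).
rewrite /GRing.scale/= quot_pi_scale; congr quot_pi.
by do 2!apply: val_inj => /=.
Qed.

Lemma killed_boundaryS {R : comPzRingType} {C : cochain_complex R}
    (K L : set R) i (z : C i) :
  K `<=` L -> killed_boundary C L i z -> killed_boundary C K i z.
Proof.
by move=> KL; case: i z => [//|i] z [w Lw <-]; exists w => // a /KL/Lw.
Qed.

Theorem proposition3p6 (R : comPzRingType) (noethR : noetherian R)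
    (m : nat) (m_ge1 : (1 <= m)%N) (x : 'I_m -> R) (regx : regular_sequence x)
    (I : set R) (genI : I = ideal_gen (range x)) (i : nat) :
  exists y : R, I y /\
    forall (E : injective_resolution (R^o : lmodType R))
           (h : local_cohomology I E i),
      exists h' : local_cohomology I E i, y *: h' = h.
Proof.
have id0 : is_ideal [set (0 : R)].
  by split=> [//|a b -> ->|r a ->]; rewrite ?addr0 ?mulr0.
have [s [y xE]] : exists s y, codom x = rcons s y.
  case/lastP: (codom x) (size_codom x) => [/=|s y _]; last by exists s, y.
  by rewrite card_ord => m0; rewrite -m0 in m_ge1.
have Iy : I y.
  have /codomP[j ->] : y \in codom x by rewrite xE mem_rcons mem_head.
  by rewrite genI; apply: sub_gen_smallest; exists j.
(* [y] is chosen before [E] and does not depend on [i]. *)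
exists y; split=> // E; apply: local_cohomology_divisible => e.
rewrite {1}genI => /(is_torsionP _ _ m_ge1)[n xe] de.
(* A positive exponent makes [y] divide [y ^+ n.+1], whence [Ky] below. *)
have := regular_modX n.+1 id0 (regular_sequence_mod _ _ regx).
set sn := [seq a ^+ n.+1 | a <- s]; set K := foldl ideal_adjoin [set 0] sn.
rewrite xE map_rcons regular_mod_rcons -/sn -/K => -[reg_sn Kyn].
have idK : is_ideal K by apply: foldl_adjoin_ideal.
have Ky : nzd_mod K y.
  case: (idK) => _ _ KM r Kry; apply: Kyn.
  by have := KM (y ^+ n) _ Kry; rewrite exprS; congr K; ring.
have injE j : injective_module (E j) by apply: ires_injective.
have concK := killed_concentrated_foldl injE _ _ _ id0 reg_sn
  (injective_resolution_concentrated E).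
have concL := killed_concentrated_adjoin injE _ _ _ idK Kyn concK.
have xSe a : a \in codom x -> a ^+ n.+1 *: e = 0.
  by move=> xa; rewrite exprS -scalerA xe// scaler0.
have killed_zero (f : E i) : killed [set 0] f by move=> _ ->; rewrite scale0r.
have Ke : killed K e.
  apply/(killed_foldl_adjoin _ _ _ id0); split=> // _ /mapP[a sa ->].
  by apply: xSe; rewrite xE mem_rcons inE sa orbT.
have bKe : killed_boundary E K i e.
  (* In the one degree where [concK] gives no vanishing, [concL] does, being concentrated one degree
     higher. *)
  have [i_eq|i_neq] := pselect (i = (size sn + 0)%N); last exact: concK.1.
  apply: killed_boundaryS (ideal_adjoin_sub K (y ^+ n.+1)) _.
  apply: concL.1 => //.
    by rewrite i_eq => /eqP; rewrite ltn_eqF.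
  apply/(killed_adjoin idK); split=> //.
  by apply: xSe; rewrite xE mem_rcons mem_head.
have [e' bKe' ye'] := killed_boundary_divisible injE _ _ _ _ idK Ky bKe.
exists e'; split=> //; last exact: killed_boundary_cocycle bKe'.
rewrite genI; apply/(is_torsionP _ _ m_ge1); exists n.+1 => a.
rewrite xE mem_rcons inE => /predU1P[->|sa].
  (* [K] does not account for [y]: here [y ^+ n.+1 *: e' = y ^+ n *: e = 0]. *)
  by rewrite exprSr -scalerA ye' xe// xE mem_rcons mem_head.
have /(killed_foldl_adjoin _ _ _ id0)[_] := killed_boundary_killed _ _ _ bKe'.
by apply; apply: map_f.
Qed.
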